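(* Let $m$ and $s$ be positive integers such that $m$ is a multiple of $3$. Then there is no balanced arithmetic tetrahedron of size $s$ in $\mathbb{Z}/m\mathbb{Z}$, i.e., for all $a,d_1,d_2,d_3\in\mathbb{Z}/m\mathbb{Z}$ the multiset $\mathrm{AS}(a,(d_1,d_2,d_3),s)$ is not balanced.
   Context: $\mathrm{AS}(a,(d_1,d_2,d_3),s)=\{a+i_1d_1+i_2d_2+i_3d_3: i\in\mathbb{N}^3,\ i_1+i_2+i_3\le s-1\}$ as a multiset of $\mathbb{Z}/m\mathbb{Z}$. A multiset is balanced if every element of $\mathbb{Z}/m\mathbb{Z}$ occurs in it with the same multiplicity. *)

(* Defs.v *)
From mathcomp Require Import all_boot all_algebra.
From mathcomp Require Import finmap multiset.

Set Implicit Arguments.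
Unset Strict Implicit.
Unset Printing Implicit Defensive.

Local Open Scope ring_scope.
Local Open Scope mset_scope.

(* 'Z_m is the ring Z/mZ only when 1 < m. *)

(* Ranging over 'I_s loses no index of N^3: i1 + i2 + i3 <= s - 1 forces each
   coordinate to be < s when 0 < s. For s = 0 there is no index and AS is
   empty. *)
Definition AS (m : nat) (a d1 d2 d3 : 'Z_m) (s : nat) : {mset 'Z_m} :=
  seq_mset [seq a + d1 *+ i.1.1 + d2 *+ i.1.2 + d3 *+ i.2
           | i : 'I_s * 'I_s * 'I_s in
               [pred i : 'I_s * 'I_s * 'I_s
               | (i.1.1 + i.1.2 + i.2 <= s - 1)%N]].

Definition balanced (m : nat) (M : {mset 'Z_m}) : Prop :=
  forall x y : 'Z_m, M x = M y.

(* Main.v *)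
Require Import Defs.
From mathcomp Require Import all_boot all_algebra.
From mathcomp Require Import finmap multiset.
From mathcomp Require Import all_order algC cyclotomic ring zify.

(** A primitive cube root of unity [w] defines a character of Z/m since 3 | m,
    and it sums to 0 over any balanced multiset.  Its sum over the tetrahedron
    is, up to a unit, the complete homogeneous symmetric polynomial
    [h_(s-1) (w^d1, w^d2, w^d3, 1)].  Such a value at four cube roots of unity
    never vanishes: by symmetry, homogeneity and conjugation of [w], only the
    arguments (1,1,1,1), (w,1,1,1), (w,w,1,1) and (1,w,w^2,1) matter, and there
    the generating series [1 / prod (1 - x t)] has explicit coefficients. *)

Set Implicit Arguments.
Unset Strict Implicit.
Unset Printing Implicit Defensive.

Import Order.TTheory GRing.Theory Num.Theory.
Local Open Scope ring_scope.

(** * Complete homogeneous symmetric polynomials as coefficient sequences *)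

Section CompleteHomogeneous.

Variable R : comNzRingType.
Implicit Types (x y c : R) (g : nat -> R) (s : seq R).

(* Coefficients of [g(t) / (1 - x t)]. *)
Fixpoint geom_conv x g n : R :=
  if n is n'.+1 then x * geom_conv x g n' + g n else g 0%N.

Definition hsym s : nat -> R := foldr geom_conv (fun n => (n == 0%N)%:R) s.

Lemma eq_geom_conv x g1 g2 : g1 =1 g2 -> geom_conv x g1 =1 geom_conv x g2.
Proof. by move=> eg; elim=> [|n IHn] /=; rewrite ?eg ?IHn. Qed.

Lemma geom_convC x y g :
  geom_conv x (geom_conv y g) =1 geom_conv y (geom_conv x g).
Proof.
(* The value at [n.+2] is reached from those at both [n] and [n.+1], so two consecutive equalities
   are carried through the induction. *)
move=> n; suff [] :
  geom_conv x (geom_conv y g) n = geom_conv y (geom_conv x g) n /\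
  geom_conv x (geom_conv y g) n.+1 = geom_conv y (geom_conv x g) n.+1 by [].
elim: n => [|n [IH0 IH1]]; first by split=> //=; ring.
have convS z f k : geom_conv z f k.+1 = z * geom_conv z f k + f k.+1 by [].
split=> //; rewrite convS IH1 [RHS]convS -[in RHS]IH1 (convS y (geom_conv x g)).
rewrite (convS x (geom_conv y g)) (convS y g n.+1) (convS x g n.+1) IH0; ring.
Qed.

Lemma geom_conv_sum x g n :
  geom_conv x g n = \sum_(i < n.+1) x ^+ i * g (n - i)%N.
Proof.
elim: n => [|n IHn] /=; first by rewrite big_ord1 expr0 mul1r.
rewrite big_ord_recl expr0 mul1r subn0 addrC IHn mulr_sumr.
by congr (_ + _); apply: eq_bigr => i _; rewrite exprS mulrA subSS.
Qed.

(** This is the substitution of [c t] for [t] in [g(t) / (1 - x t)]. *)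
Lemma geom_convZ c x g n :
  geom_conv (c * x) (fun k => c ^+ k * g k) n = c ^+ n * geom_conv x g n.
Proof. by elim: n => //= n ->; rewrite exprS mulrDr !mulrA (mulrAC c x). Qed.

Lemma hsym_scale c s n : hsym [seq c * x | x <- s] n = c ^+ n * hsym s n.
Proof.
elim: s n => [|x s IHs] n /=; first by case: n => [|n]; rewrite ?mulr0 ?mul1r.
by rewrite -geom_convZ; apply: eq_geom_conv.
Qed.

Lemma hsym_cat_cons s x t : hsym (s ++ x :: t) =1 hsym (x :: s ++ t).
Proof.
elim: s => //= y s IHs n.
by rewrite (eq_geom_conv _ IHs) geom_convC.
Qed.

Lemma perm_hsym s t : perm_eq s t -> hsym s =1 hsym t.
Proof.
elim: s t => [|x s IHs] t; first by rewrite perm_sym => /perm_nilP->.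
move=> st n; have /splitPr xt : x \in t by rewrite -(perm_mem st) mem_head.
case: xt st => t1 t2.
rewrite perm_sym perm_catC /= perm_cons perm_sym => st.
rewrite hsym_cat_cons /=; apply: eq_geom_conv => k; apply: IHs.
by rewrite (perm_trans st) // perm_catC.
Qed.

Lemma hsym_1 n : hsym [:: 1] n = 1.
Proof. by elim: n => //= n; rewrite /hsym /= => ->; rewrite mul1r addr0. Qed.

(** The fourth argument [1] acts as a slack variable: it turns the monomials of degree at most
    [s - 1] in [x], [y], [z] into those of degree exactly [s - 1]. *)
Lemma hsym_tetrahedron x y (z : R) (s : nat) : (0 < s)%N ->
  \sum_(i : 'I_s * 'I_s * 'I_s | (i.1.1 + i.1.2 + i.2 <= s - 1)%N)
     x ^+ i.1.1 * y ^+ i.1.2 * z ^+ i.2 = hsym [:: x; y; z; 1] (s - 1).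
Proof.
case: s => // n _; rewrite subn1 /=.
(* Expanding the convolutions gives ranges that shrink with the outer indices; [ext] widens them to
   the common range ['I_n.+1]. *)
have ext k (F : nat -> R) : (k <= n)%N ->
    \sum_(i < k.+1) F i = \sum_(i < n.+1 | (i <= k)%N) F i.
  by move=> kn; rewrite (big_ord_widen n.+1) //; apply: eq_bigl.
rewrite big_mkcond -(pair_bigA _ (fun (p : 'I_n.+1 * 'I_n.+1) (q : 'I_n.+1) =>
  if (p.1 + p.2 + q <= n)%N then x ^+ p.1 * y ^+ p.2 * z ^+ q else 0)) /=.
rewrite -(pair_bigA _ (fun p1 p2 : 'I_n.+1 => \sum_(q < n.+1)
  if (p1 + p2 + q <= n)%N then x ^+ p1 * y ^+ p2 * z ^+ q else 0)) /=.
rewrite /hsym /= geom_conv_sum; apply: eq_bigr => i _.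
rewrite geom_conv_sum mulr_sumr.
rewrite (ext (n - i)%N (fun j => x ^+ i * (y ^+ j * geom_conv z
  (geom_conv 1 (fun n => (n == 0%N)%:R)) (n - i - j)))) ?leq_subr //.
rewrite [RHS]big_mkcond; apply: eq_bigr => j _.
case: ifP => ij; last first.
  by apply: big1 => k _; case: ifP => //; move: ij; lia.
rewrite geom_conv_sum !mulr_sumr.
rewrite (ext (n - i - j)%N (fun k => x ^+ i * (y ^+ j * (z ^+ k *
  geom_conv 1 (fun n => (n == 0%N)%:R) (n - i - j - k))))); last by lia.
rewrite [RHS]big_mkcond; apply: eq_bigr => k _.
rewrite (_ : (k <= n - i - j)%N = (i + j + k <= n)%N); last first.
  by have := ltn_ord i; lia.
by case: ifP => // _; rewrite [geom_conv 1 _ _]hsym_1 mulr1 !mulrA.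
Qed.

End CompleteHomogeneous.

(** * Nonvanishing at cube roots of unity *)

Lemma nat_mod3_ind (P : nat -> Prop) :
  (forall k, P (3 * k)%N /\ P (3 * k).+1 /\ P (3 * k).+2) -> forall n, P n.
Proof.
move=> Pk n; have [P0 [P1 P2]] := Pk (n %/ 3)%N.
have := divn_eq n 3; have := ltn_pmod n (isT : 0 < 3)%N.
by case: (n %% 3)%N => [|[|[|//]]] _ ->; rewrite mulnC ?addn0 ?addn1 ?addn2.
Qed.

Section CubeRoots.

Variables (R : numDomainType) (w : R).
Hypothesis w_prim : w ^+ 2 + w + 1 = 0.

Let w2E : w ^+ 2 = - 1 - w.
Proof. by rewrite -[LHS]subr0 -w_prim; ring. Qed.

Lemma cube_root_expr3 : w ^+ 3 = 1.
Proof. by rewrite exprS w2E; ring: w2E. Qed.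

Lemma cube_root_expr_mod k : w ^+ (k %% 3) = w ^+ k.
Proof. exact: expr_mod cube_root_expr3. Qed.

Lemma cube_root_neq0 : w != 0.
Proof.
apply/eqP=> w0; move: cube_root_expr3; rewrite w0 expr0n => /eqP.
by rewrite eq_sym oner_eq0.
Qed.

(* The conjugate factor turns [p - q w^2] into the positive norm
   [p^2 + p q + q^2]. *)
Lemma cube_root_comb_neq0 p q : (0 < p)%N -> p%:R - q%:R * w ^+ 2 != 0.
Proof.
move=> p0; apply/eqP=> e0.
have: (p%:R - q%:R * w ^+ 2) * (p%:R - q%:R * w) = (p ^ 2 + p * q + q ^ 2)%:R.
  by ring: w2E.
by rewrite e0 mul0r => /eqP; rewrite eq_sym pnatr_eq0; lia.
Qed.

Let hsym_11 n : hsym [:: 1; 1] n = n.+1%:R :> R.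
Proof.
elim: n => // n IHn.
by rewrite -natr1 -IHn -[X in _ + X](hsym_1 R n.+1) -[X in X + _]mul1r.
Qed.

Lemma hsym_1111_neq0 n : hsym [:: 1; 1; 1; 1] n != 0 :> R.
Proof.
apply: lt0r_neq0.
have pos (g : nat -> R) : (forall k, 0 < g k) -> forall k, 0 < geom_conv 1 g k.
  by move=> g0; elim=> //= k IHk; rewrite mul1r addr_gt0.
rewrite /hsym /=; apply: (pos) => k; apply: pos => {}k.
by rewrite [geom_conv _ _ _]hsym_11 ltr0n.
Qed.

(** The generating series is [(1 - w^2 t) / ((1 - t^3) (1 - t)^2)], so each coefficient is
    [p - q w^2], with [p] and [q] consecutive coefficients of [1 / ((1 - t^3) (1 - t)^2)]. *)
Lemma hsym_w111_neq0 n : hsym [:: w; 1; 1; 1] n != 0 :> R.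
Proof.
pose t := hsym [:: 1; 1; 1] : nat -> R; pose u := hsym [:: w; 1; 1; 1].
have tS k : t k.+1 = t k + k.+2%:R.
  by rewrite -hsym_11 /t /hsym /= mul1r.
have uS k : u k.+1 = w * u k + t k.+1 by [].
have t0 : t 0%N = 1 by [].
have u0 : u 0%N = 1 by [].
(* Over three steps [t k.+1] gets the factor [w^2 + w + 1 = 0]; only its increments survive. *)
have step k : u k.+3 = u k + k.+4%:R - k.+3%:R * w ^+ 2.
  by rewrite !uS !tS; ring: w2E.
rewrite -/(u n).
have [p [q [p0 ->]]] : exists p q, (0 < p)%N /\ u n = p%:R - q%:R * w ^+ 2;
  last exact: cube_root_comb_neq0.
have [k le_kn] := ubnP n; elim: k n le_kn => // k IHk [|[|[|n]]] lenk.
- by exists 1%N, 0%N; split=> //; rewrite u0; ring.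
- by exists 2%N, 1%N; split=> //; rewrite uS tS u0 t0; ring: w2E.
- by exists 3%N, 2%N; split=> //; rewrite !uS !tS u0 t0; ring: w2E.
have [|p [q [p0 e]]] := IHk n; first by lia.
exists (p + n.+4)%N, (q + n.+3)%N; split; first by lia.
by rewrite step e; ring.
Qed.

(** The generating series is [(1 - w^2 t)^2 / (1 - t^3)^2]: the coefficients at [3k], [3k+1], [3k+2]
    are [k+1] times [1], [-2 w^2], [w]. *)
Lemma hsym_ww11_neq0 n : hsym [:: w; w; 1; 1] n != 0 :> R.
Proof.
pose v := hsym [:: w; 1; 1] : nat -> R; pose u := hsym [:: w; w; 1; 1].
have vS k : v k.+1 = w * v k + k.+2%:R.
  by rewrite -hsym_11.
have uS k : u k.+1 = w * u k + v k.+1 by [].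
have closed k : u (3 * k)%N = k.+1%:R /\ v (3 * k)%N = k.+1%:R - k%:R * w ^+ 2.
  elim: k => [|k [uE vE]].
    by rewrite muln0 mul0r subr0.
  by rewrite mulnS !addSn add0n !uS !vS uE vE; split; ring: w2E.
rewrite -/(u n); elim/nat_mod3_ind: n => k; have [uE vE] := closed k.
split; first by rewrite uE pnatr_eq0.
have -> : u (3 * k).+1 = - 2%:R * w ^+ 2 * k.+1%:R.
  by rewrite uS vS uE vE; ring: w2E.
have -> : u (3 * k).+2 = w * k.+1%:R.
  by rewrite !uS !vS uE vE; ring: w2E.
by rewrite !mulf_neq0 ?oppr_eq0 ?pnatr_eq0 ?expf_neq0 ?cube_root_neq0.
Qed.

(** The generating series is [1 / ((1 - t^3) (1 - t))], whose [n]-th coefficient is [n %/ 3 + 1]. *)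
Lemma hsym_1ww21_neq0 n : hsym [:: 1; w; w ^+ 2; 1] n != 0 :> R.
Proof.
pose g := hsym [:: w ^+ 2; 1] : nat -> R.
pose v := hsym [:: w; w ^+ 2; 1]; pose u := hsym [:: 1; w; w ^+ 2; 1].
have gS k : g k.+1 = w ^+ 2 * g k + 1.
  by rewrite -(hsym_1 R k.+1).
have vS k : v k.+1 = w * v k + g k.+1 by [].
have uS k : u k.+1 = 1 * u k + v k.+1 by [].
have closed k : [/\ u (3 * k)%N = k.+1%:R, v (3 * k)%N = 1 & g (3 * k)%N = 1].
  elim: k => [|k [uE vE gE]] //.
  by rewrite mulnS !addSn add0n !uS !vS !gS uE vE gE; split; ring: w2E.
have nz k : k.+1%:R != 0 :> R by rewrite pnatr_eq0.
rewrite -/(u n); elim/nat_mod3_ind: n => k; have [uE vE gE] := closed k.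
have -> : u (3 * k).+2 = k.+1%:R by rewrite !uS !vS !gS uE vE gE; ring: w2E.
have -> : u (3 * k).+1 = k.+1%:R by rewrite !uS !vS !gS uE vE gE; ring: w2E.
by rewrite uE.
Qed.

End CubeRoots.

(* Orbit representatives of 4-multisets of Z/3 under the affine group:
   translations come from scaling, the factor 2 from conjugating [w]. *)
Definition orbit_reps : seq (seq nat) :=
  [:: [:: 0; 0; 0; 0]; [:: 1; 0; 0; 0]; [:: 1; 1; 0; 0]; [:: 0; 1; 2; 0]]%N.

Lemma orbit_repsP e1 e2 e3 :
  exists c k es, [/\ k \in [:: 1; 2]%N, es \in orbit_reps &
    perm_eq [:: e1 %% 3; e2 %% 3; e3 %% 3; 0]%N
            [seq (k * e + c) %% 3 | e <- es]%N].
Proof.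
(* Only residues modulo 3 matter, which leaves 27 triples to check by computation. *)
have check : all (fun f1 => all (fun f2 => all (fun f3 =>
    has (fun c => has (fun k => has (fun es =>
      perm_eq [:: f1; f2; f3; 0]%N [seq (k * e + c) %% 3 | e <- es]%N)
    orbit_reps) [:: 1; 2]%N) (iota 0 3)) (iota 0 3)) (iota 0 3)) (iota 0 3).
  by vm_compute.
have mod3 e : (e %% 3 \in iota 0 3)%N by rewrite mem_iota /= add0n ltn_pmod.
have /hasP[c _ /hasP[k kP /hasP[es esP eP]]] :=
  allP (allP (allP check _ (mod3 e1)) _ (mod3 e2)) _ (mod3 e3).
by exists c, k, es.
Qed.

Lemma hsym_cube_roots_neq0 (R : numDomainType) (w : R) e1 e2 e3 n :
  w ^+ 2 + w + 1 = 0 -> hsym [:: w ^+ e1; w ^+ e2; w ^+ e3; 1] n != 0.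
Proof.
move=> w_prim; have [c [k [es [kP esP /(perm_map (GRing.exp w)) pE]]]] :=
  orbit_repsP e1 e2 e3.
rewrite /= expr0 !cube_root_expr_mod // in pE; rewrite (perm_hsym pE).
(* The affine map on exponents becomes scaling by [w ^+ c] after replacing [w] by [w ^+ k], which
   for [k = 2] is the conjugate root. *)
have -> : [seq w ^+ x | x <- [seq (k * e + c) %% 3 | e <- es]%N] =
          [seq w ^+ c * x | x <- [seq (w ^+ k) ^+ e | e <- es]].
  rewrite -!map_comp; apply: eq_map => e /=.
  by rewrite cube_root_expr_mod // exprD exprM mulrC.
rewrite hsym_scale mulf_neq0 ?expf_neq0 ?(cube_root_neq0 w_prim) //.
have wk_prim : (w ^+ k) ^+ 2 + w ^+ k + 1 = 0.
  move: kP; rewrite !inE => /orP[]/eqP->; first by rewrite expr1.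
  rewrite -exprM -(cube_root_expr_mod w_prim (2 * 2)) expr1 -[RHS]w_prim.
  by ring.
move: esP; rewrite !inE => /or4P[]/eqP->; rewrite [map _ _]/= ?expr0 ?expr1.
- exact: hsym_1111_neq0.
- exact: hsym_w111_neq0.
- exact: hsym_ww11_neq0.
- exact: hsym_1ww21_neq0.
Qed.

(** * Characters of Z/m and balanced multisets *)

(** Grouping the indices by their value under [f] makes the common multiplicity, read off at [0], a
    factor of the sum of [chi]. *)
Lemma balanced_sum (R : nzRingType) (m : nat) (I : finType) (P : pred I)
    (f : I -> 'Z_m) (chi : 'Z_m -> R) :
  balanced (seq_mset [seq f i | i in P]) -> \sum_x chi x = 0 ->
  \sum_(i | P i) chi (f i) = 0.
Proof.
move=> bal chi0.
rewrite (partition_big f xpredT) //=.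
pose N := seq_mset [seq f i | i in P] 0.
rewrite (eq_bigr (fun x => chi x *+ N)) => [|x _].
  by rewrite sumrMnl chi0 mul0rn.
rewrite (eq_bigr (fun=> chi x)) => [|i /andP[_ /eqP->] //].
rewrite sumr_const; congr (_ *+ _); rewrite /N (bal 0 x) mset_seqE.
rewrite count_map cardE -size_filter /enum_mem -filter_predI.
by congr size; apply: eq_filter => i /=; rewrite andbC.
Qed.

Lemma cube_root_exists : exists w : algC, w ^+ 2 + w + 1 = 0.
Proof.
have [w] := C_prim_root_exists (isT : 0 < 3)%N.
move=> w_prim; exists w.
have /eqP : (w - 1) * (w ^+ 2 + w + 1) = w ^+ 3 - 1 by ring.
rewrite (prim_expr_order w_prim) subrr mulf_eq0 subr_eq0.
case/orP=> [/eqP w1 | /eqP //].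
by move: (prim_order_dvd w_prim 1); rewrite w1 expr1n eqxx.
Qed.

(** Addition in ['Z_m] reduces modulo [(Zp_trunc m).+2], whatever [m] is; hence the form of the
    hypothesis on [w]. *)
Lemma Zp_char_add (R : nzRingType) (w : R) (m : nat) (x y : 'Z_m) :
  w ^+ (Zp_trunc m).+2 = 1 -> w ^+ (x + y)%R = w ^+ x * w ^+ y.
Proof. by move=> wm; rewrite /= expr_mod // exprD. Qed.

Lemma sum_Zp_char (R : idomainType) (w : R) (m : nat) :
  w ^+ (Zp_trunc m).+2 = 1 -> w != 1 -> \sum_(x : 'Z_m) w ^+ x = 0.
Proof.
move=> wm w1; set S := \sum_x _.
(* Translating the index by [1] multiplies the sum by [w]. *)
have: S = w * S.
  rewrite {1}/S (reindex_inj (addrI 1)) mulr_sumr; apply: eq_bigr => x _.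
  by rewrite Zp_char_add // expr1.
move/eqP; rewrite -subr_eq0 -{1}[S]mul1r -mulrBl mulf_eq0 subr_eq0 eq_sym.
by rewrite (negPf w1) => /eqP.
Qed.

Lemma Zp_char_muln (R : nzRingType) (w : R) (m : nat) (x : 'Z_m) k :
  w ^+ (Zp_trunc m).+2 = 1 -> w ^+ (x *+ k)%R = (w ^+ x) ^+ k.
Proof.
move=> wm; elim: k => [|k IHk]; first by rewrite mulr0n !expr0.
by rewrite mulrS Zp_char_add // IHk exprS.
Qed.

Local Close Scope ring_scope.

Theorem theorem3p13 (m s : nat) (m_gt0 : 0 < m) (s_gt0 : 0 < s)
    (m_dvd3 : 3 %| m) (a d1 d2 d3 : 'Z_m) :
  ~ balanced (AS a d1 d2 d3 s).
Proof.
move=> bal; have [w w_prim] := cube_root_exists.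
(* This bound makes [(Zp_trunc m).+2] equal to [m], so that [3 %| m] applies to it. *)
have m_gt1 : 1 < m by apply: leq_trans (dvdn_leq m_gt0 m_dvd3).
have wm : (w ^+ (Zp_trunc m).+2 = 1)%R.
  by rewrite Zp_cast // -(divnK m_dvd3) mulnC exprM cube_root_expr3 // expr1n.
have w1 : w != 1%R.
  apply/eqP => w1; move/eqP: w_prim; rewrite w1 expr1n.
  by rewrite gt_eqF ?addr_gt0 ?ltr01.
have := balanced_sum bal (sum_Zp_char wm w1).
(* Each term is [w ^+ a] times a monomial in [w ^+ d1], [w ^+ d2], [w ^+ d3]; the nonzero factor
   [w ^+ a] is then cancelled. *)
under eq_bigr => i _ do rewrite !Zp_char_add // !Zp_char_muln // -!mulrA.
rewrite -mulr_sumr => /eqP; rewrite mulf_eq0 expf_eq0.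
rewrite (negPf (cube_root_neq0 w_prim)) andbF /=; apply/negP.
under eq_bigr => i _ do rewrite mulrA.
by rewrite hsym_tetrahedron // hsym_cube_roots_neq0.
Qed.
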